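(* Let $m\ge 0$ be an integer and let $n,k$ be integers with $0\le k<5^m$ and $0\le n<5^m$. Then for all integers $i,j$ with $0\le j\le i\le 4$, $$5 \mid \binom{n+i5^m}{k+j5^m}_F \iff 5\mid \binom{n}{k}_F.$$
   Context: The Fibonacci sequence is $F_1=F_2=1$, $F_n=F_{n-1}+F_{n-2}$ for $n\ge 3$. The fibotorial is $n!_F = F_nF_{n-1}\cdots F_1$ for $n>0$, and $0!_F=1$. The fibonomial coefficient is $\binom{n}{k}_F=\frac{n!_F}{k!_F\,(n-k)!_F}$ for $0\le k\le n$, and $\binom{n}{k}_F=0$ otherwise (in particular when $k>n$); it is always an integer. *)

(* Defs.v *)
From mathcomp Require Import all_boot.

Set Implicit Arguments.
Unset Strict Implicit.
Unset Printing Implicit Defensive.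

(* The index 0 is not used by the sequence F_1 = F_2 = 1, F_3 = 2, and so on;
   the value fib 0 = 0 is the one compatible with the recurrence. *)
Fixpoint fib (n : nat) : nat :=
  match n with
  | 0 => 0
  | n'.+1 => match n' with
             | 0 => 1
             | n''.+1 => fib n' + fib n''
             end
  end.

Definition fibotorial (n : nat) : nat := \prod_(1 <= i < n.+1) fib i.

(* The quotient %/ is exact: see fibonomialE. *)
Definition fibonomial (n k : nat) : nat :=
  if k <= n then fibotorial n %/ (fibotorial k * fibotorial (n - k)) else 0.

Lemma fibSS n : fib n.+2 = fib n.+1 + fib n.
Proof. by []. Qed.

Lemma fib_gt0 n : 0 < n -> 0 < fib n.
Proof.
case: n => // n _; elim: n => // n IHn.
by rewrite fibSS addn_gt0 IHn.
Qed.

Lemma fibotorialS n : fibotorial n.+1 = fib n.+1 * fibotorial n.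
Proof. by rewrite /fibotorial big_nat_recr //= mulnC. Qed.

Lemma fibotorial_gt0 n : 0 < fibotorial n.
Proof.
by elim: n => [|n IHn]; rewrite ?fibotorialS ?muln_gt0 ?fib_gt0 // /fibotorial
  big_geq.
Qed.

Lemma fib_addS m n : fib (m + n).+1 = fib m.+1 * fib n.+1 + fib m * fib n.
Proof.
elim: m n => [|m IHm] n; first by rewrite mul1n mul0n addn0.
rewrite addSnnS IHm !fibSS mulnDr mulnDl -!addnA; congr (_ + _).
exact: addnC.
Qed.

Lemma dvdn_fibotorial a b :
  fibotorial a * fibotorial b %| fibotorial (a + b).
Proof.
have [s le_s] := ubnP (a + b); elim: s => // s IHs in a b le_s *.
case: a b le_s => [|a] [|b] le_s.
- by rewrite addn0 /fibotorial big_geq.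
- by rewrite add0n {1}/fibotorial big_geq // mul1n.
- by rewrite addn0 {2}/fibotorial big_geq // muln1.
rewrite addnS (fibotorialS (a.+1 + b)) (fib_addS a.+1 b) mulnDl dvdn_add //.
  rewrite -mulnA dvdn_mull // (fibotorialS b) mulnCA dvdn_mul // IHs //.
  by move: le_s; rewrite addnS ltnS.
rewrite mulnAC dvdn_mulr // fibotorialS -mulnA dvdn_mul //.
by rewrite addSnnS IHs // -ltnS.
Qed.

Lemma fibonomialE n k : k <= n ->
  fibonomial n k * (fibotorial k * fibotorial (n - k)) = fibotorial n.
Proof.
move=> le_kn; rewrite /fibonomial le_kn divnK //.
by have := dvdn_fibotorial k (n - k); rewrite subnKC.
Qed.

(* Main.v *)
(** The proof rests on [logn 5 (fib n) = logn 5 n] for [n > 0], which makes the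
    fibonomial coefficient and the binomial coefficient have the same 5-adic
    valuation; the claim is then Lucas' congruence
    ['C(n + i * 5 ^ m, k + j * 5 ^ m) = 'C(n, k) * 'C(i, j)] modulo 5, where
    ['C(i, j)] is prime to 5.  The valuation of [fib] follows from
    [5 %| fib n <-> 5 %| n] and [fib (5 * n) = 5 * fib n * Q] with
    [Q] congruent to [(fib n.-1 + 3 * fib n) ^ 4], hence to a power of 3,
    modulo 5. *)
Require Import Defs.
From mathcomp Require Import all_boot.
From mathcomp Require Import zify ring.

(** Five steps of the recurrence multiply by 3 modulo 5, and 3 is invertible there. *)
Lemma dvd5_fib n : (5 %| fib n) = (5 %| n).
Proof.
have [s le_s] := ubnP n; elim: s n le_s => // s IHs [|[|[|[|[|n]]]]] // le_s.
have -> : fib n.+4.+1 = fib n.+1 * 5 + 3 * fib n by rewrite !fibSS; ring.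
rewrite (dvdn_addr _ (dvdn_mull _ (dvdnn 5))) Gauss_dvdr // IHs; last by lia.
by rewrite -[n.+4.+1]/(5 + n) dvdn_addr.
Qed.

(** Modulo 5, X^2 - X - 1 is (X - 3)^2, so F_{n+1} - 3 F_n is geometric of ratio 3; multiplying it
    by 3 gives a form without subtraction. *)
Lemma fib_mod5_geometric n : fib n + 3 * fib n.+1 = 3 ^ n.+1 %[mod 5].
Proof.
elim: n => // n IHn; rewrite expnS -modnMmr -IHn modnMmr fibSS.
have -> : 3 * (fib n + 3 * fib n.+1)
        = fib n.+1 * 5 + (fib n.+1 + 3 * (fib n.+1 + fib n)) by ring.
by rewrite modnMDl.
Qed.

Lemma fib_mul5 n (a := fib n.+1) (c := fib n) :
  fib (5 * n.+1) =
  5 * a * (a ^ 4 + 3 * a ^ 3 * c + 4 * a ^ 2 * c ^ 2 + 2 * a * c ^ 3 + c ^ 4).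
Proof.
(* The index 5(n + 1) is reached by two doublings, to 2n + 1 and 2n + 2, then to 4n + 3 and 4n + 4,
   and a last addition of n + 1. *)
have E2 : fib (n.+1 + n).+1 = a * a + a * c + c * a.
  by rewrite fib_addS fibSS -/a -/c; ring.
have E2p : fib (n + n).+1 = a * a + c * c by rewrite fib_addS.
have E4 : fib (n.+1 + n + (n.+1 + n).+1).+1 =
    (fib (n.+1 + n).+1 + fib (n.+1 + n)) * fib (n.+1 + n).+1
    + fib (n.+1 + n) * fib (n.+1 + n).+1.
  by rewrite fib_addS fibSS; ring.
have E4p : fib (n.+1 + n + (n.+1 + n)).+1 =
    fib (n.+1 + n).+1 * fib (n.+1 + n).+1 + fib (n.+1 + n) * fib (n.+1 + n).
  by rewrite fib_addS.
have -> : 5 * n.+1 = (n.+1 + (n.+1 + n + (n.+1 + n).+1)).+1 by lia.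
rewrite fib_addS fibSS E4 addnS E4p E2 addSn E2p -/a -/c; ring.
Qed.

Lemma logn5_fib n : 0 < n -> logn 5 (fib n) = logn 5 n.
Proof.
have [s le_s] := ubnP n; elim: s n le_s => // s IHs n le_s n_gt0.
have [/dvdnP[k Dn] | n5] := boolP (5 %| n); last first.
  by rewrite lognE [RHS]lognE dvd5_fib (negPf n5) !andbF.
case: k Dn => [|k] Dn; first by rewrite Dn in n_gt0.
rewrite Dn mulnC fib_mul5; set a := fib k.+1; set c := fib k; set Q := (X in _ * X).
have Q5 : ~~ (5 %| Q).
  have EQ : (c + 3 * a) ^ 4 = (16 * a ^ 4 + 21 * a ^ 3 * c + 10 * a ^ 2 * c ^ 2
                               + 2 * a * c ^ 3) * 5 + Q by rewrite /Q; ring.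
  have : ~~ (5 %| (c + 3 * a) ^ 4).
    by rewrite Euclid_dvdX // andbT /dvdn fib_mod5_geometric -/(5 %| _) Euclid_dvdX.
  by rewrite EQ (dvdn_addr _ (dvdn_mull _ (dvdnn 5))).
have a_gt0 : 0 < a by apply: fib_gt0.
have Q_gt0 : 0 < Q by case: Q Q5.
rewrite !lognM ?muln_gt0 // IHs //; last by lia.
by rewrite [logn 5 Q]lognE (negPf Q5) !andbF addn0.
Qed.

Lemma logn5_fibotorial n : logn 5 (fibotorial n) = logn 5 n`!.
Proof.
elim: n => [|n IHn]; first by rewrite /fibotorial big_geq.
by rewrite fibotorialS factS !lognM ?fib_gt0 ?fibotorial_gt0 ?fact_gt0 //
  logn5_fib // IHn.
Qed.

Lemma dvd5_fibonomial n k : (5 %| fibonomial n k) = (5 %| 'C(n, k)).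
Proof.
have [le_kn | lt_nk] := leqP k n; last first.
  by rewrite /fibonomial leqNgt lt_nk bin_small.
have fib_n := fibonomialE le_kn; have bin_n := bin_fact le_kn.
have f_gt0 : 0 < fibonomial n k.
  by have := fibotorial_gt0 n; rewrite -fib_n muln_gt0 => /andP[].
have b_gt0 : 0 < 'C(n, k) by rewrite bin_gt0.
have := logn5_fibotorial n; rewrite -fib_n -bin_n.
rewrite !lognM ?muln_gt0 ?fibotorial_gt0 ?fact_gt0 // !logn5_fibotorial.
move/addIn => eq_log.
by rewrite -[5]expn1 !pfactor_dvdn // eq_log.
Qed.

Section LucasPrimePower.

Variables (p m : nat).
Hypothesis p_prime : prime p.
Let q := p ^ m.

Let q_gt0 : 0 < q. Proof. by rewrite expn_gt0 prime_gt0. Qed.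

(** Since l * 'C(q, l) = q * 'C(q - 1, l - 1), if p did not divide 'C(q, l) then q would divide l,
    which is too small. *)
Lemma prime_dvd_bin_pexp l : 0 < l < q -> p %| 'C(q, l).
Proof.
case: l => // l /= lt_lq; apply: contraTT lt_lq => pC; rewrite -leqNgt.
apply: dvdn_leq => //; rewrite -(@Gauss_dvdl _ _ 'C(q, l.+1)).
  by rewrite -mul_bin_diag dvdn_mulr.
by rewrite coprimeXl // prime_coprime.
Qed.

(* Coefficientwise form of [(1 + X) ^ (q + n) = (1 + X ^ q) * (1 + X) ^ n]. *)
Lemma bin_add_pexp n k :
  'C(q + n, k) = 'C(n, k) + (if q <= k then 'C(n, k - q) else 0) %[mod p].
Proof.
elim: n k => [|n IHn] k.
  rewrite addn0 !bin0n subn_eq0; case: (ltngtP k q) => [lt_kq | lt_qk | ->].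
  - case: k lt_kq => [|k] lt_kq; first by rewrite bin0.
    by rewrite addn0 mod0n; apply/eqP; apply: prime_dvd_bin_pexp.
  - by rewrite bin_small //; case: k lt_qk.
  - by rewrite binn gtn_eqF.
case: k => [|k]; first by rewrite !bin0 leqNgt q_gt0.
rewrite addnS !binS -modnDm !IHn modnDm; congr (_ %% _).
case: (ltngtP q k.+1) => [lt_qk | lt_kq | eq_qk].
- by rewrite -ltnS lt_qk subSn // binS addnACA.
- by rewrite leqNgt ltnW // !addn0.
- by rewrite eq_qk ltnn subnn !bin0 addn0 addnAC.
Qed.

(** Induction on i: [bin_add_pexp] removes one q from the upper index, and its two terms match those
    of Pascal's rule for 'C(i, j). *)
Lemma lucas_pexp n k i j : n < q -> k < q ->
  'C(n + i * q, k + j * q) = 'C(n, k) * 'C(i, j) %[mod p].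
Proof.
move=> lt_nq lt_kq; elim: i j => [|i IHi] [|j].
- by rewrite !addn0 bin0 muln1.
- by rewrite addn0 bin_small ?muln0 // mulSn; lia.
- rewrite mulSn addnCA bin_add_pexp addn0 leqNgt lt_kq addn0.
  by have := IHi 0; rewrite addn0 !bin0.
rewrite mulSn addnCA bin_add_pexp ifT; last by rewrite mulSn addnCA leq_addr.
rewrite -modnDm IHi mulSn addnCA addKn IHi modnDm.
by rewrite binS mulnDr.
Qed.

End LucasPrimePower.

Theorem corollary3p2 (m n k : nat) (hk : k < 5 ^ m) (hn : n < 5 ^ m)
  (i j : nat) (hji : j <= i) (hi : i <= 4) :
  5 %| fibonomial (n + i * 5 ^ m) (k + j * 5 ^ m) <-> 5 %| fibonomial n k.
Proof.
(* For i <= 4 the only values are 1, 2, 3, 4 and 6. *)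
have bin_ij : ~~ (5 %| 'C(i, j)).
  by case: i hji hi => [|[|[|[|[|i]]]]] //; case: j => [|[|[|[|[|j]]]]].
by rewrite !dvd5_fibonomial /dvdn lucas_pexp // -/(5 %| _) Euclid_dvdM //
  (negPf bin_ij) orbF.
Qed.
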